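(* Let $(a_n)_{n=1}^\infty$ be a sequence of positive integers. The following are equivalent: (1) The sequence $(a_n)_{n=1}^\infty$ is bounded. (2) For every basis (of any $p$-Banach space, $0<p\leqslant 1$), the basis is $\mathcal F_{(a_n)}$-strong partially greedy if and only if it is strong partially greedy.
   Context: Let $\mathbb N=\{1,2,\dots\}$ and let $\mathbb N^{<\infty}$ be the collection of finite subsets of $\mathbb N$. A $p$-Banach space ($0<p\leqslant 1$) over $\mathbb F$ ($=\mathbb R$ or $\mathbb C$) is a vector space complete under a homogeneous, positive definite $\|\cdot\|$ with $\|x+y\|^p\leqslant\|x\|^p+\|y\|^p$. All spaces $X$ are separable and infinite dimensional; $X^*$ is the dual of $X$. A basis $\mathcal B$ of $X$ is a sequence $(e_n)_{n=1}^\infty\subset X$ whose span is dense in $X$, for which there is a unique sequence $(e_n^* )_n\subset X^*$ with $e_m^*(e_n)=\delta_{m,n}$ for all $m,n$, and such that $0<\inf_n\{\|e_n\|,\|e_n^*\|\}\leqslant\sup_n\{\|e_n\|,\|e_n^*\|\}<\infty$. For $A\in\mathbb N^{<\infty}$, $P_A(x)=\sum_{n\in A}e_n^*(x)e_n$; for $k\geqslant 0$, $S_k(x)=\sum_{n=1}^k e_n^*(x)e_n$. For $x\in X$ and an integer $m\geqslant 0$, $\Lambda_m(x)$ denotes any set with $|\Lambda_m(x)|=m$ and $\min_{n\in\Lambda_m(x)}|e_n^*(x)|\geqslant\max_{n\notin\Lambda_m(x)}|e_n^*(x)|$ (the choice need not be unique; $\Lambda_0(x)=\emptyset$). For $A,B\subset\mathbb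 N$, $A<B$ means $a<b$ for all $a\in A$, $b\in B$ (vacuously true if $A$ or $B$ is empty). A basis is strong partially greedy if there is $C>0$ such that $\|x-P_{\Lambda_m(x)}(x)\|\leqslant C\inf_{0\leqslant k\leqslant m}\|x-S_k(x)\|$ for all $x\in X$, $m\in\mathbb N$ and all choices of $\Lambda_m(x)$. For a collection $\mathcal F$ of finite subsets of $\mathbb N$ with $\emptyset\in\mathcal F$, a basis is $\mathcal F$-strong partially greedy if there is $\Delta\geqslant 1$ such that for all $x\in X$, $m\geqslant 0$ and all choices of $\Lambda_m(x)$, $\|x-P_{\Lambda_m(x)}(x)\|\leqslant\Delta\inf\{\|x-P_F(x)\|: F\in\mathcal F,\ |F|\leqslant m,\ F\setminus\Lambda_m(x)<\Lambda_m(x)\setminus F\}$. $\mathcal F_{(a_n)}:=\{\emptyset\}\cup\{k+\{a_1,a_1+a_2,\dots,a_1+a_2+\cdots+a_\ell\}: k\geqslant 0,\ \ell\geqslant 1\}$ ($k,\ell$ integers), where $k+A=\{k+n:n\in A\}$. *)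

(* Defs.v *)
From mathcomp Require Import all_boot all_order all_algebra.
From mathcomp Require Import finmap complex.
From mathcomp Require Import boolp classical_sets functions cardinality reals exp.

Set Implicit Arguments.
Unset Strict Implicit.
Unset Printing Implicit Defensive.

Import Order.TTheory GRing.Theory Num.Theory.

Local Open Scope classical_set_scope.
Local Open Scope ring_scope.

(* The positive integers 1, 2, 3, ... are represented by 0, 1, 2, ...:
   [e n], [es n] and [a n] stand for e_(n+1), e*_(n+1) and a_(n+1), and a finite
   set A of positive integers is represented by {n - 1 : n in A} : {fset nat}.
   Cardinalities, set differences and the order are unaffected by the shift. *)

Variant scalars := RealScalars | ComplexScalars.

Definition scalar_field (R : realType) (F : scalars) : numFieldType :=
  match F with
  | RealScalars => R
  | ComplexScalars => R[i]
  end.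

(* The absolute value, taken in [R] also for complex scalars, where the
   generic norm of MathComp would take its values in [R[i]]. *)
Definition modulus (R : realType) (F : scalars) : scalar_field R F -> R :=
  match F with
  | RealScalars => fun x : R => `|x|
  | ComplexScalars => fun z : R[i] => Normc.normc z
  end.

Section Spaces.
Variables (R : realType) (F : scalars) (X : lmodType (scalar_field R F)).
Variable N : X -> R.

Definition norm_complete : Prop :=
  forall u : nat -> X,
    (forall eps : R, 0 < eps ->
       exists k, forall m n, (k <= m)%N -> (k <= n)%N -> N (u m - u n) < eps) ->
    exists x : X, forall eps : R, 0 < eps ->
      exists k, forall n, (k <= n)%N -> N (u n - x) < eps.

Record p_banach (p : R) : Prop := PBanach {
  p_banach_ge0 : forall x, 0 <= N x;
  p_banach_definite : forall x, N x = 0 -> x = 0;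
  p_banach_homogeneous : forall c x, N (c *: x) = modulus c * N x;
  p_banach_triangle : forall x y, N (x + y) `^ p <= N x `^ p + N y `^ p;
  p_banach_complete : norm_complete }.

Definition norm_dense (D : set X) : Prop :=
  forall (x : X) (eps : R), 0 < eps -> exists2 y, D y & N (x - y) < eps.

Definition separable : Prop := exists D : set X, countable D /\ norm_dense D.

Definition linear_span (e : nat -> X) (m : nat) : set X :=
  [set x | exists c : nat -> scalar_field R F, x = \sum_(i < m) c i *: e i].

Definition infinite_dimensional : Prop :=
  forall (e : nat -> X) (m : nat), exists x, ~ linear_span e m x.

Definition dual_values (f : X -> scalar_field R F) : set R :=
  [set modulus (f x) | x in [set x | N x <= 1]].

Definition in_dual (f : X -> scalar_field R F) : Prop :=
  scalar f /\ has_ubound (dual_values f).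

Definition dual_norm (f : X -> scalar_field R F) : R := sup (dual_values f).

Definition biorthogonal (e : nat -> X) (es : nat -> X -> scalar_field R F) : Prop :=
  forall m n, es m (e n) = (m == n)%:R.

(* [es] is the sequence of coordinate functionals of the basis [e]. *)
Record basis (e : nat -> X) (es : nat -> X -> scalar_field R F) : Prop := Basis {
  basis_dense : norm_dense (\bigcup_m linear_span e m);
  basis_dual : forall n, in_dual (es n);
  basis_biorthogonal : biorthogonal e es;
  basis_unique : forall es' : nat -> X -> scalar_field R F,
    (forall n, in_dual (es' n)) -> biorthogonal e es' -> es' = es;
  basis_inf_gt0 : 0 < inf (range (N \o e) `|` range (dual_norm \o es));
  basis_sup_lty : has_ubound (range (N \o e) `|` range (dual_norm \o es)) }.

Section Greedy.
Variables (e : nat -> X) (es : nat -> X -> scalar_field R F).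

Definition proj (A : {fset nat}) (x : X) : X := \sum_(n <- A) es n x *: e n.

Definition partial_sum (k : nat) (x : X) : X := \sum_(n < k) es n x *: e n.

Definition greedy_set (x : X) (m : nat) (L : {fset nat}) : Prop :=
  #|` L| = m /\
  forall n j, n \in L -> j \notin L -> modulus (es j x) <= modulus (es n x).

Definition fset_before (A B : {fset nat}) : Prop :=
  forall i j, i \in A -> j \in B -> (i < j)%N.

Definition strong_partially_greedy : Prop :=
  exists2 C : R, 0 < C &
    forall (x : X) (m : nat) (L : {fset nat}), (0 < m)%N -> greedy_set x m L ->
      N (x - proj L x) <=
        C * inf [set N (x - partial_sum k x) | k in [set k | (k <= m)%N]].

Definition family_strong_partially_greedy (Fam : set {fset nat}) : Prop :=
  exists2 D : R, 1 <= D &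
    forall (x : X) (m : nat) (L : {fset nat}), greedy_set x m L ->
      N (x - proj L x) <=
        D * inf [set N (x - proj A x) | A in
                  [set A | [/\ Fam A, (#|` A| <= m)%N &
                            fset_before (A `\` L)%fset (L `\` A)%fset]]].

End Greedy.
End Spaces.

(* The predecessor accounts for the shift explained above: the (j+1)-th
   element of k + {a_1, ..., a_1 + ... + a_l} is k + a_1 + ... + a_(j+1). *)
Definition sum_family (a : nat -> nat) : set {fset nat} :=
  [set A | A = fset0 \/
     exists k l : nat, (0 < l)%N /\
       A = [fset (k + \sum_(i < j.+1) a i)%N.-1 | j in iota 0 l]%fset].

(* Main.v *)
Require Import Defs.
From HB Require Import structures.
From mathcomp Require Import all_boot all_order all_algebra.
From mathcomp Require Import finmap complex.
From mathcomp Require Import boolp classical_sets functions cardinality reals exp.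
From mathcomp Require Import zify lra.

Set Implicit Arguments.
Unset Strict Implicit.
Unset Printing Implicit Defensive.

Import Order.TTheory GRing.Theory Num.Theory.
Local Open Scope classical_set_scope.
Local Open Scope ring_scope.

(** Both greedy properties are instances of one: strong partially greedy is the
family property for the initial segments {1, ..., k} ([spg_initial]). So the
question is when one family controls another.

If (a_n) is bounded, the crux is the following trick, in [block_dominated]. Let
A < B be finite sets with |A| <= |B|, let the coordinates of x on A be at most
those on B in modulus, let A be contained in a member G of the family, with G
disjoint from B, and let b be in B. In the vector that agrees with x on A and B
and equals e*_b(x) on G \ A, the set L = (G \ A) u B is greedy, the competitor G
is admissible because G \ L = A precedes L \ G = B, and the two remainders are
P_A x and P_B x. Hence ||P_A x|| <= D ||P_B x||, with no use of convexity. This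
extends to all such A and B, without reference to G, if each interval
{1, ..., k} is a union of boundedly many sets of size at most one or belonging to
the family ([interval_dominated]). Applying the family property with the competitor {} to
x - P_F x bounds x - P_{F u L} x and P_{L \ F} x; the latter controls
P_{F \ L} x, and these pieces add up to x - P_L x. So a covering family yields
the greedy inequality against every finite F with |F| <= |L| and F \ L < L \ F
([covering_transfer]). Initial segments cover trivially; if a_n <= M, the M
translates by 0, ..., M - 1 of {a_1, a_1 + a_2, ...}, truncated, cover everything
from a_1 on, and fewer than M points remain ([sum_family_covers]).

If (a_n) is unbounded, call a finite set G a transversal if it has at most one
point in common with each member of the family, and take the Banach space with
norm the supremum over transversals G of the sums of |x_n| over G. Projecting
onto a subset of a member of the family changes such a sum by at most one
coordinate, so the unit vectors are strong partially greedy for the family with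
constant 2. But there are transversals G of any size n
([sum_family_transversal]): after finitely many points not exceeding b, the point
s_r + b + 1, where s_r = a_1 + ... + a_r and a_{r+1} > b + 1, lies in no translate
that contains one of the earlier points, because such a translate is by less
than b, and so this point falls between the images of s_r and s_{r+1}. As the
indicator of G has norm n while that of a member of the family of the same size,
far out, has norm 1, the basis is not strong partially greedy ([transversal_space_not_spg]). *)

(** * Scalars *)

Section Scalars.
Variables (R : realType) (F : scalars).
Local Notation K := (scalar_field R F).
Implicit Types c d : K.

Lemma modulus_ge0 c : 0 <= modulus c.
Proof. by case: F c => c; [exact: normr_ge0 | case: c => x y; exact: sqrtr_ge0]. Qed.

Lemma modulus0 : modulus (0 : K) = 0.
Proof. by case: F; [exact: normr0 | exact: Normc.normc0]. Qed.

Lemma modulus1 : modulus (1 : K) = 1.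
Proof. by case: F; [exact: normr1 | exact: Normc.normc1]. Qed.

Lemma modulus0_eq0 c : modulus c = 0 -> c = 0.
Proof. by case: F c => c; [exact: normr0_eq0 | exact: Normc.eq0_normc]. Qed.

Lemma modulusM c d : modulus (c * d) = modulus c * modulus d.
Proof. by case: F c d => c d; [exact: normrM | exact: Normc.normcM]. Qed.

Lemma modulusD c d : modulus (c + d) <= modulus c + modulus d.
Proof. by case: F c d => c d; [exact: ler_normD | exact: le_normcD]. Qed.

Lemma modulusN c : modulus (- c) = modulus c.
Proof. by case: F c => c; [exact: normrN | exact: normcN]. Qed.

Lemma modulus_surj (r : R) : 0 <= r -> exists c, modulus c = r.
Proof.
case: F => r0; first by exists r; exact: ger0_norm.
exists (r%:C)%C; rewrite /modulus /= expr0n addr0 sqrtr_sqr ger0_norm //.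
Qed.

End Scalars.

Lemma normc_le_ReIm (R : realType) (z : R[i]) :
  Normc.normc z <= `|complex.Re z| + `|complex.Im z|.
Proof.
case: z => x y /=; rewrite -[leRHS]ger0_norm ?addr_ge0// -sqrtr_sqr ler_sqrt ?sqr_ge0//.
rewrite sqrrD -!normrX !(ger0_norm (sqr_ge0 _)) lerD2r lerDl.
by rewrite mulrn_wge0// mulr_ge0.
Qed.

Lemma ReIm_le_normc (R : realType) (z : R[i]) :
  `|complex.Re z| <= Normc.normc z /\ `|complex.Im z| <= Normc.normc z.
Proof.
by case: z => x y /=; split; rewrite -sqrtr_sqr ler_sqrt ?addr_ge0 ?sqr_ge0//
  ?lerDl ?lerDr ?sqr_ge0.
Qed.

Lemma real_cauchy_cvg (R : realType) (u : nat -> R) :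
  (forall eps : R, 0 < eps -> exists k, forall m n, (k <= m)%N -> (k <= n)%N ->
     `|u m - u n| < eps) ->
  exists l, forall eps : R, 0 < eps -> exists k, forall n, (k <= n)%N -> `|u n - l| < eps.
Proof.
move=> uC; pose S := [set t | exists k, forall n, (k <= n)%N -> t <= u n].
have tail eps : 0 < eps -> exists k, S (u k - eps) /\ ubound S (u k + eps) /\
    forall n, (k <= n)%N -> `|u n - u k| < eps.
  move=> /uC[k uk]; exists k; split; last split.
  - exists k => n kn; have := uk k n (leqnn k) kn.
    by rewrite ltr_norml => /andP[_]; lra.
  - move=> t [j tj]; have := uk (maxn j k) k (leq_maxr _ _) (leqnn k).
    by have := tj (maxn j k) (leq_maxl _ _); rewrite ltr_norml => ? /andP[_]; lra.
  - by move=> n kn; exact: uk.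
have Sub : has_ubound S by have [k [_ [Sk _]]] := tail 1 ltr01; exists (u k + 1).
exists (sup S) => eps eps0; have e3 : 0 < eps / 2 by lra.
have [k [Sk [ubk uk]]] := tail _ e3; exists k => n kn.
have le1 := ub_le_sup Sub Sk.
have le2 : sup S <= u k + eps / 2 by apply: ge_sup => //; exists (u k - eps / 2).
by have := uk n kn; rewrite !ltr_norml => /andP[? ?]; apply/andP; split; lra.
Qed.

Lemma scalar_cauchy_cvg (R : realType) (F : scalars) (u : nat -> scalar_field R F) :
  (forall eps : R, 0 < eps -> exists k, forall m n, (k <= m)%N -> (k <= n)%N ->
     modulus (u m - u n) < eps) ->
  exists l, forall eps : R, 0 < eps -> exists k, forall n, (k <= n)%N ->
     modulus (u n - l) < eps.
Proof.
case: F u => u uC; first exact: real_cauchy_cvg.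
have [x ux] : exists l, forall eps : R, 0 < eps ->
    exists k, forall n, (k <= n)%N -> `|complex.Re (u n) - l| < eps.
  apply: real_cauchy_cvg => eps /uC[k uk]; exists k => m n km kn.
  apply: le_lt_trans (uk m n km kn).
  have -> : complex.Re (u m) - complex.Re (u n) = complex.Re (u m - u n : R[i]).
    by case: (u m) (u n) => ? ? [].
  exact: (ReIm_le_normc _).1.
have [y uy] : exists l, forall eps : R, 0 < eps ->
    exists k, forall n, (k <= n)%N -> `|complex.Im (u n) - l| < eps.
  apply: real_cauchy_cvg => eps /uC[k uk]; exists k => m n km kn.
  apply: le_lt_trans (uk m n km kn).
  have -> : complex.Im (u m) - complex.Im (u n) = complex.Im (u m - u n : R[i]).
    by case: (u m) (u n) => ? ? [].
  exact: (ReIm_le_normc _).2.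
exists (x +i* y)%C => eps eps0; have e2 : 0 < eps / 2 by lra.
have [[k uk] [j uj]] := (ux _ e2, uy _ e2).
exists (maxn k j) => n; rewrite geq_max => /andP[/uk xn /uj yn].
apply: le_lt_trans (normc_le_ReIm _) _; rewrite [ltRHS]splitr ltrD//.
  by move: xn; case: (u n).
by move: yn; case: (u n).
Qed.

Lemma scalar_dense_seq (R : realType) (F : scalars) :
  exists q : nat -> scalar_field R F,
    forall c (eps : R), 0 < eps -> exists n, modulus (c - q n) < eps.
Proof.
have ratP (x eps : R) : 0 < eps -> exists r : rat, `|x - ratr r| < eps.
  move=> eps0; have [|r] := @rat_in_itvoo R (x - eps) (x + eps); first by lra.
  by rewrite in_itv /= => /andP[? ?]; exists r; rewrite ltr_norml; apply/andP; split; lra.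
case: F.
  exists (fun n : nat => ratr (odflt 0 (@choice.unpickle _ n : option rat)) : R)
    => c eps /(ratP c)[r].
  by exists (choice.pickle r); rewrite choice.pickleK.
exists (fun n : nat => let r := odflt (0, 0) (@choice.unpickle _ n : option (rat * rat)) in
  (ratr r.1 +i* ratr r.2)%C : R[i]) => c eps eps0.
have e2 : 0 < eps / 2 by lra.
have [[r cr] [s cs]] := (ratP (complex.Re c) _ e2, ratP (complex.Im c) _ e2).
exists (choice.pickle (r, s)); rewrite choice.pickleK.
apply: le_lt_trans (normc_le_ReIm _) _; rewrite [ltRHS]splitr ltrD//.
  by move: cr; case: (c).
by move: cs; case: (c).
Qed.

(** * Greedy inequalities against an infimum *)

Lemma le_mul_infP (R : realType) (S : set R) (y C : R) :
  S !=set0 -> (forall s, S s -> 0 <= s) -> 0 < C ->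
  y <= C * inf S <-> forall s, S s -> y <= C * s.
Proof.
move=> S0 Sge0 C0; split=> [yS s Ss | yS].
  apply: le_trans yS _; rewrite ler_pM2l//; apply: ge_inf => //.
  by exists 0 => t; exact: Sge0.
rewrite -ler_pdivrMl//; apply: lb_le_inf => // s Ss.
by rewrite ler_pdivrMl//; exact: yS.
Qed.

Lemma le_mul_inf_imageP (R : realType) (T : Type) (P : set T) (f : T -> R) (y C : R) :
  P !=set0 -> (forall t, 0 <= f t) -> 0 < C ->
  y <= C * inf [set f t | t in P] <-> forall t, P t -> y <= C * f t.
Proof.
move=> [t0 Pt0] f0 C0; rewrite le_mul_infP//; last 2 first.
- by exists (f t0), t0.
- by move=> _ [t _ <-].
by split=> [h t Pt | h _ [t Pt <-]]; apply: h => //; exists t.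
Qed.

Definition initial_segment (k : nat) : {fset nat} := [fset n in iota 0 k]%fset.

Lemma in_initial_segment k n : (n \in initial_segment k) = (n < k)%N.
Proof. by rewrite in_fset /= mem_iota. Qed.

Lemma card_initial_segment k : #|` initial_segment k| = k.
Proof. by rewrite /initial_segment card_fseq undup_id ?iota_uniq ?size_iota. Qed.

Lemma initial_segment0 : initial_segment 0 = fset0.
Proof. by apply/fsetP => n; rewrite in_initial_segment. Qed.

Lemma initial_segment_fset0 : range initial_segment fset0.
Proof. by exists 0%N => //; exact: initial_segment0. Qed.

(** The sets are confined to the interval, so that they stay disjoint from any set
lying beyond it; singletons are allowed because no member of the family need
contain the first few integers. *)
Definition covers_intervals (Fam : set {fset nat}) :=
  exists q : nat, forall k : nat, exists T : seq {fset nat},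
    [/\ (size T <= q)%N,
        forall A, A \in T -> (Fam A \/ (#|` A| <= 1)%N) /\ (A `<=` initial_segment k)%fset &
        forall n, (n < k)%N -> exists2 A, A \in T & n \in A].

Lemma initial_segments_cover : covers_intervals (range initial_segment).
Proof.
exists 1%N => k; exists [:: initial_segment k]; split=> //.
  by move=> A; rewrite inE => /eqP->; split=> //; left; exists k.
by move=> n nk; exists (initial_segment k); rewrite ?mem_head ?in_initial_segment.
Qed.

(** * Biorthogonal systems *)

Section LinearFunctional.
Variables (R : realType) (F : scalars) (X : lmodType (scalar_field R F)).
Variables (f : X -> scalar_field R F) (fL : scalar f).

Lemma scalar_fun0 : f 0 = 0.
Proof.
have := fL 1 0 0; rewrite scaler0 addr0 mul1r => /eqP.
by rewrite -subr_eq0 opprD addNKr oppr_eq0 => /eqP.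
Qed.

Lemma scalar_funZ c x : f (c *: x) = c * f x.
Proof. by have := fL c x 0; rewrite addr0 scalar_fun0 addr0. Qed.

Lemma scalar_funB x y : f (x - y) = f x - f y.
Proof. by rewrite [x - y]addrC -scaleN1r fL mulN1r addrC. Qed.

Lemma scalar_fun_sum (I : Type) (r : seq I) (c : I -> scalar_field R F) (g : I -> X) :
  f (\sum_(i <- r) c i *: g i) = \sum_(i <- r) c i * f (g i).
Proof.
elim: r => [|i r IH]; first by rewrite !big_nil scalar_fun0.
by rewrite !big_cons fL IH.
Qed.

End LinearFunctional.

Section Combination.
Variables (R : realType) (F : scalars) (X : lmodType (scalar_field R F)).
Variables (e : nat -> X).

Definition combination (c : nat -> scalar_field R F) (A : {fset nat}) : X :=
  \sum_(n <- A) c n *: e n.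

Lemma eq_combination c d A : {in A, c =1 d} -> combination c A = combination d A.
Proof. by move=> cd; apply: eq_fbigr => n /cd ->. Qed.

Lemma combination_split B c A :
  combination c A = combination c (A `&` B)%fset + combination c (A `\` B)%fset.
Proof.
rewrite /combination (@big_fsetID _ _ _ _ (mem B)); congr (_ + _); apply: eq_fbigl => n.
  by rewrite !inE.
by rewrite !inE /= andbC.
Qed.

Lemma combinationB c A B : (B `<=` A)%fset ->
  combination c A - combination c B = combination c (A `\` B)%fset.
Proof. by move=> /fsetIidPr BA; rewrite (combination_split B) BA addrC addKr. Qed.

Variable es : nat -> X -> scalar_field R F.
Hypothesis es_scalar : forall n, scalar (es n).
Hypothesis e_es : biorthogonal e es.

Lemma coord_combination c A j :
  es j (combination c A) = if j \in A then c j else 0.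
Proof.
rewrite (scalar_fun_sum (es_scalar j)); case: ifPn => jA.
  rewrite (big_fsetD1 j)//= big1_fset; first by rewrite addr0 e_es eqxx mulr1.
  by move=> n; rewrite in_fsetD1 => /andP[/negPf nj _] _; rewrite e_es eq_sym nj mulr0.
rewrite big1_fset// => n nA _; rewrite e_es; case: eqP => [jn|]; last by rewrite mulr0.
by rewrite jn nA in jA.
Qed.

Lemma proj_fset0 x : proj e es fset0 x = 0.
Proof. by rewrite /proj big_seq_fset0. Qed.

Lemma coord_proj A x j : es j (proj e es A x) = if j \in A then es j x else 0.
Proof. exact: coord_combination. Qed.

Lemma proj_combination c A L : (L `<=` A)%fset ->
  proj e es L (combination c A) = combination c L.
Proof. by move=> /fsubsetP LA; apply: eq_combination => n /LA nA; rewrite coord_combination nA. Qed.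

End Combination.

Lemma partial_sum_proj (R : realType) (F : scalars) (X : lmodType (scalar_field R F))
    (e : nat -> X) es k x :
  partial_sum e es k x = proj e es (initial_segment k) x.
Proof.
rewrite /partial_sum -(big_mkord xpredT (fun n => es n x *: e n)) /index_iota subn0.
apply: perm_big; apply: uniq_perm => [||n]; [exact: iota_uniq | exact: fset_uniq |].
by rewrite in_initial_segment mem_iota.
Qed.

(** If m vectors spanned the space, the m + 1 coefficient rows of the first m + 1
members of the system would be linearly dependent, which its coordinates
forbid. *)
Lemma biorthogonal_infinite_dimensional (R : realType) (F : scalars)
    (X : lmodType (scalar_field R F)) (e : nat -> X) es :
  (forall n, scalar (es n)) -> biorthogonal e es -> infinite_dimensional X.
Proof.
move=> esL e_es f m; apply: contrapT => /forallNP spans.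
have /choice[c eE] j : exists c : nat -> scalar_field R F,
    e j = \sum_(i < m) c i *: f i by have /contrapT := spans (e j).
pose C : 'M[scalar_field R F]_(m.+1, m) := \matrix_(j, i) c j i.
have /rowV0Pn[v /sub_kermxP vC v0] : kermx C != 0.
  by rewrite kermx_eq0 /row_free neq_ltn ltnS rank_leq_col.
have ve0 : \sum_(j < m.+1) v 0 j *: e j = 0.
  under eq_bigr do rewrite eE scaler_sumr.
  rewrite exchange_big big1// => i _.
  have /matrixP/(_ 0 i) := vC; rewrite !mxE => vC0.
  under eq_bigr do rewrite scalerA.
  rewrite -scaler_suml (_ : \sum_j _ = 0) ?scale0r// -[RHS]vC0.
  by apply: eq_bigr => j _; rewrite mxE.
case/negP: v0; apply/eqP/rowP => j; rewrite mxE.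
have := congr1 (es j) ve0; rewrite (scalar_fun_sum (esL j)) (scalar_fun0 (esL j)) => <-.
rewrite (bigD1 j)//= e_es eqxx mulr1 big1 ?addr0// => i ij.
by rewrite e_es eq_sym (inj_eq val_inj) (negPf ij) mulr0.
Qed.

(** * Transfer between families in a p-Banach space *)

Section Transfer.
Variables (R : realType) (F : scalars) (X : lmodType (scalar_field R F)).
Variables (N : X -> R) (p : R).
Hypotheses (p0 : 0 < p) (NB : p_banach N p).

Lemma p_norm0 : N 0 = 0.
Proof. by rewrite -(scale0r (0 : X)) (p_banach_homogeneous NB) modulus0 mul0r. Qed.

Lemma p_normN x : N (- x) = N x.
Proof. by rewrite -scaleN1r (p_banach_homogeneous NB) modulusN modulus1 mul1r. Qed.

(** This weak form of the triangle inequality, with k = 2^(1/p), is all that the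
transfer argument needs of the exponent p. *)
Lemma quasi_triangle : exists2 k : R, 1 <= k &
  forall x y, N (x + y) <= k * (N x + N y).
Proof.
have pn0 : p != 0 by rewrite gt_eqF.
exists (2 `^ p^-1) => [|x y].
  have {1}<- : 1 `^ p^-1 = 1 :> R by rewrite powR1.
  by apply: ge0_ler_powR; rewrite ?nnegrE ?invr_ge0 ?(ltW p0)//; lra.
have [Nx Ny] := (p_banach_ge0 NB x, p_banach_ge0 NB y).
have s0 : 0 <= N x + N y by exact: addr_ge0.
have rootK t : 0 <= t -> (t `^ p) `^ p^-1 = t.
  by move=> t0; rewrite -powRrM mulfV// powRr1.
rewrite -[leLHS]rootK ?(p_banach_ge0 NB)// -[N x + N y]rootK// -powRM ?powR_ge0//.
apply: ge0_ler_powR; rewrite ?invr_ge0 ?nnegrE ?mulr_ge0 ?powR_ge0 ?(ltW p0)//.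
apply: le_trans (p_banach_triangle NB x y) _; rewrite mulrDl !mul1r lerD//.
  by apply: ge0_ler_powR; rewrite ?nnegrE ?(ltW p0)// lerDl.
by apply: ge0_ler_powR; rewrite ?nnegrE ?(ltW p0)// lerDr.
Qed.

Lemma dual_norm_bound f x : in_dual N f -> modulus (f x) <= dual_norm N f * N x.
Proof.
move=> [fL fB]; have [x0|x0] := eqVneq (N x) 0.
  by rewrite x0 (p_banach_definite NB x0) (scalar_fun0 fL) modulus0 mulr0.
have Nx : 0 < N x by rewrite lt_def x0 (p_banach_ge0 NB).
have [c cE] : exists c : scalar_field R F, modulus c = (N x)^-1.
  by apply: modulus_surj; rewrite invr_ge0 ltW.
rewrite -ler_pdivrMr// mulrC -cE -modulusM -(scalar_funZ fL).
apply: ub_le_sup => //.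
by exists (c *: x) => //=; rewrite (p_banach_homogeneous NB) cE mulVf.
Qed.

(** Two dual systems agree on the span, and bounded functionals that agree on a
dense set are equal. *)
Lemma dual_system_unique (e : nat -> X) es es' :
  norm_dense N (\bigcup_m linear_span e m) ->
  (forall n, in_dual N (es n)) -> biorthogonal e es ->
  (forall n, in_dual N (es' n)) -> biorthogonal e es' -> es' = es.
Proof.
move=> De esD esB es'D es'B; apply/funext => n; apply/funext => x.
apply/eqP; rewrite -subr_eq0; apply/eqP/modulus0_eq0/eqP.
rewrite eq_le modulus_ge0 andbT; apply/ler_addgt0Pr => eps eps0; rewrite add0r.
pose V := Num.max 0 (dual_norm N (es n)) + Num.max 0 (dual_norm N (es' n)) + 1.
have V0 : 0 < V by rewrite ltr_wpDl// addr_ge0// le_max lexx.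
have [y [m _ [c yE]] xy] := De x (eps / V) (divr_gt0 eps0 V0).
have agree : es' n y = es n y.
  rewrite yE (scalar_fun_sum (es'D n).1) (scalar_fun_sum (esD n).1).
  by apply: eq_bigr => i _; rewrite esB es'B.
have -> : es' n x - es n x = es' n (x - y) + - es n (x - y).
  by rewrite (scalar_funB (es'D n).1) (scalar_funB (esD n).1) agree opprB addrA subrK.
apply: le_trans (modulusD _ _) _; rewrite modulusN.
apply: (@le_trans _ _ (V * N (x - y))); last first.
  by rewrite mulrC -ler_pdivlMr// ltW.
have dom g : in_dual N g -> modulus (g (x - y)) <= Num.max 0 (dual_norm N g) * N (x - y).
  move=> gD; apply: le_trans (dual_norm_bound (x - y) gD) _.
  by rewrite ler_wpM2r ?(p_banach_ge0 NB)// le_max lexx orbT.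
have := dom _ (esD n); have := dom _ (es'D n); rewrite /V !mulrDl mul1r.
by have := p_banach_ge0 NB (x - y); lra.
Qed.

Lemma dense_span_separable (e : nat -> X) :
  norm_dense N (\bigcup_m linear_span e m) -> separable N.
Proof.
move=> De; have [q qd] := scalar_dense_seq R F; have [k k1 tri] := quasi_triangle.
have k0 : 0 < k by exact: lt_le_trans k1.
pose g (s : seq nat) := \sum_(i < size s) q (nth 0%N s i) *: e i.
have approx m (c : nat -> scalar_field R F) (eps : R) : 0 < eps -> exists2 s : seq nat, size s = m &
    N (\sum_(i < m) c i *: e i - g s) < eps.
  elim: m eps => [|m IH] eps eps0.
    by exists [::] => //; rewrite /g !big_ord0 subrr p_norm0.
  have d0 : 0 < eps / k / 2 by rewrite !divr_gt0.
  have [s sm sE] := IH _ d0.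
  have em : 0 < N (e m) + 1 by rewrite ltr_wpDl// (p_banach_ge0 NB).
  have [n nE] := qd (c m) _ (divr_gt0 d0 em).
  exists (rcons s n); first by rewrite size_rcons sm.
  have -> : g (rcons s n) = g s + q n *: e m.
    rewrite /g size_rcons big_ord_recr /= nth_rcons sm ltnn eqxx; congr (_ + _).
    by apply: eq_bigr => i _; rewrite nth_rcons sm ltn_ord.
  rewrite big_ord_recr /= opprD addrACA -scalerBl.
  apply: le_lt_trans (tri _ _) _; rewrite mulrC -ltr_pdivlMr// [ltRHS]splitr ltrD//.
  rewrite (p_banach_homogeneous NB); apply: (@le_lt_trans _ _ (modulus (c m - q n) * (N (e m) + 1))).
    by rewrite ler_wpM2l ?modulus_ge0// lerDl.
  by rewrite -ltr_pdivlMr.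
exists (range g); split; first exact: card_le_trans (card_image_le _ _) (countableP _).
move=> x eps eps0; have d0 : 0 < eps / k / 2 by rewrite !divr_gt0.
have [y [m _ [c yE]] xy] := De x _ d0.
have [s _ sE] := approx m c _ d0; exists (g s); first by exists s.
rewrite -[x](subrK y) -addrA; apply: le_lt_trans (tri _ _) _.
by rewrite mulrC -ltr_pdivlMr// [ltRHS]splitr ltrD// yE.
Qed.

Variables (e : nat -> X) (es : nat -> X -> scalar_field R F).

(** The family property with the infimum removed: one inequality for each
admissible competitor A. *)
Definition greedy_bound (Fam : set {fset nat}) (D : R) :=
  forall x m L A, greedy_set es x m L -> Fam A -> (#|` A| <= m)%N ->
    fset_before (A `\` L)%fset (L `\` A)%fset ->
    N (x - proj e es L x) <= D * N (x - proj e es A x).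

Lemma family_spgP Fam : Fam fset0 ->
  family_strong_partially_greedy N e es Fam <->
  exists2 D : R, 1 <= D & greedy_bound Fam D.
Proof.
move=> F0.
pose P m (L A : {fset nat}) := [/\ Fam A, (#|` A| <= m)%N &
  fset_before (A `\` L)%fset (L `\` A)%fset].
have P0 m L : P m L fset0 by split; rewrite ?cardfs0// => i j; rewrite fset0D.
have key D x m L : 1 <= D -> N (x - proj e es L x) <=
      D * inf [set N (x - proj e es A x) | A in [set A | P m L A]] <->
    forall A, P m L A -> N (x - proj e es L x) <= D * N (x - proj e es A x).
  move=> D1; apply: le_mul_inf_imageP; [by exists fset0; exact: P0 | | exact: (lt_le_trans ltr01 D1)].
  by move=> A; exact: (p_banach_ge0 NB).
split=> -[D D1 h]; exists D => //.
  by move=> x m L A gL FA Am bA; apply: (key D x m L D1).1; [exact: h | split].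
by move=> x m L gL; apply: (key D x m L D1).2 => A [FA Am bA]; exact: h gL FA Am bA.
Qed.

(** For initial segments the order condition holds automatically, and m = 0, which
only the family property considers, forces L and A to be empty. *)
Lemma spg_initial : strong_partially_greedy N e es <->
  family_strong_partially_greedy N e es (range initial_segment).
Proof.
have I0 := initial_segment_fset0.
rewrite family_spgP//.
have key C x m L : 0 < C -> N (x - proj e es L x) <=
      C * inf [set N (x - partial_sum e es k x) | k in [set k | (k <= m)%N]] <->
    forall k, (k <= m)%N -> N (x - proj e es L x) <= C * N (x - partial_sum e es k x).
  move=> C0; apply: le_mul_inf_imageP => //; first by exists 0%N.
  by move=> k; exact: (p_banach_ge0 NB).
split.
  case=> C C0 h; exists (Num.max 1 C); first by rewrite le_max lexx.
  move=> x m L A gL [k _ <-{A}]; rewrite card_initial_segment => km _.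
  have [m0|] := posnP m.
    have /eqP-> : k == 0%N by rewrite -leqn0 -m0.
    case: gL; rewrite m0 => /cardfs0_eq -> _.
    rewrite initial_segment0.
    by rewrite ler_peMl ?(p_banach_ge0 NB)// le_max lexx.
  move=> m0; rewrite -partial_sum_proj.
  apply: (@le_trans _ _ (C * N (x - partial_sum e es k x))).
    by apply: (key C x m L C0).1 => //; exact: h.
  by rewrite ler_wpM2r ?(p_banach_ge0 NB)// le_max lexx orbT.
case=> D D1 h; have D0 := lt_le_trans ltr01 D1; exists D => // x m L m0 gL.
apply: (key D x m L D0).2 => k km; rewrite partial_sum_proj.
apply: h gL _ _ _ => //; first by rewrite card_initial_segment.
move=> i j; rewrite !in_fsetD !in_initial_segment => /andP[_ ik] /andP[kj _].
by apply: leq_trans ik _; rewrite leqNgt.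
Qed.

Hypothesis Bas : basis N e es.

Let esL n : scalar (es n) := (basis_dual Bas n).1.
Let e_es : biorthogonal e es := basis_biorthogonal Bas.

Lemma coord_bounded : exists2 V : R, 0 <= V &
  forall n x, modulus (es n x) <= V * N x /\ N (e n) <= V.
Proof.
have [V ubV] := basis_sup_lty Bas.
have eV n : N (e n) <= V by apply: ubV; left; exists n.
have V0 : 0 <= V := le_trans (p_banach_ge0 NB (e 0%N)) (eV 0%N).
exists V => // n x; split=> //.
apply: le_trans (dual_norm_bound x (basis_dual Bas n)) _.
by rewrite ler_wpM2r ?(p_banach_ge0 NB)//; apply: ubV; right; exists n.
Qed.

Definition coord_dominated (x : X) (A B : {fset nat}) :=
  forall n j, n \in A -> j \in B -> modulus (es n x) <= modulus (es j x).

(** Padding [A] to the family member [G] with coordinates of the size of some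
x_b, b in B, makes [G] an admissible competitor to the greedy set (G \ A) u B; the
two remainders are the two projections of the conclusion. *)
Lemma block_dominated Fam (D : R) (A B G : {fset nat}) x : 0 <= D -> greedy_bound Fam D -> Fam G ->
  (A `<=` G)%fset -> [disjoint G & B]%fset ->
  (#|` A| <= #|` B|)%N -> fset_before A B -> coord_dominated x A B ->
  N (proj e es A x) <= D * N (proj e es B x).
Proof.
move=> D0 gb FG AG GB AB bAB dAB.
have [B0|[b bB]] := fset_0Vmem B.
  move: AB; rewrite B0 cardfs0 leqn0 cardfs_eq0 => /eqP ->.
  by rewrite proj_fset0 p_norm0 mulr0.
have nGB n : n \in G -> n \notin B by move=> nG; exact: (fdisjointP GB).
pose c n := if n \in (G `\` A)%fset then es b x else es n x.
pose L := ((G `\` A) `|` B)%fset; pose w := combination e c (G `|` B)%fset.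
have LS : (L `<=` G `|` B)%fset by rewrite fsetSU// fsubsetDl.
have DL : ((G `|` B) `\` L)%fset = A :> {fset nat}.
  apply/fsetP => n; rewrite !inE; case nA: (n \in A) => /=.
    by rewrite (fsubsetP AG _ nA) (negPf (nGB _ (fsubsetP AG _ nA))).
  by case: (n \in G); case: (n \in B).
have DG : ((G `|` B) `\` G)%fset = B :> {fset nat}.
  apply/fsetP => n; rewrite !inE; case nG: (n \in G) => //=.
  by rewrite (negPf (nGB _ nG)).
have cw j : es j w = if j \in (G `|` B)%fset then c j else 0.
  exact: coord_combination.
have -> : proj e es A x = w - proj e es L w.
  rewrite proj_combination// combinationB// DL; apply: eq_combination => n nA.
  by rewrite /c in_fsetD nA.
have -> : proj e es B x = w - proj e es G w.
  rewrite proj_combination ?fsubsetUl// combinationB ?fsubsetUl// DG.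
  apply: eq_combination => n nB; rewrite /c in_fsetD.
  by case: ifP => // /andP[_ /nGB]; rewrite nB.
have GL : (G `\` L)%fset = A :> {fset nat}.
  rewrite -DL; apply/fsetP => n; rewrite !inE.
  by case: (n \in A); case: (n \in G); case: (n \in B).
have LG : (L `\` G)%fset = B :> {fset nat}.
  by rewrite -DG; apply/fsetP => n; rewrite !inE; case: (n \in A); case: (n \in G).
apply: (gb w #|` L|) => //; last by rewrite GL LG.
  split=> // n j; rewrite !cw => nL jL; rewrite (fsubsetP LS _ nL).
  case: ifP => jS; last by rewrite modulus0 modulus_ge0.
  have jA : j \in A by rewrite -DL in_fsetD jL.
  rewrite /c (in_fsetD _ _ j) jA /=; case: ifP => [_|nG]; first exact: dAB.
  by apply: dAB => //; move: nL; rewrite in_fsetU nG.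
have -> : #|` L| = (#|` (G `\` A)%fset| + #|` B|)%N.
  have GAB : ((G `\` A) `&` B)%fset = fset0 :> {fset nat}.
    apply/fsetP => n; rewrite !inE; case nG: (n \in G); rewrite ?andbF//.
    by rewrite (negPf (nGB _ nG)) andbF.
  by rewrite cardfsU GAB cardfs0 subn0.
by rewrite -(cardfsID A G) (fsetIidPr AG) addnC leq_add2l.
Qed.

Lemma singleton_dominated : exists2 V : R, 0 <= V & forall (A B : {fset nat}) x,
  (#|` A| <= 1)%N -> (#|` A| <= #|` B|)%N -> coord_dominated x A B ->
  N (proj e es A x) <= V * N (proj e es B x).
Proof.
have [V V0 hV] := coord_bounded; exists (V * V); first exact: mulr_ge0.
move=> A B x A1 AB dAB; have [->|] := eqVneq A fset0.
  by rewrite proj_fset0 p_norm0 mulr_ge0 ?mulr_ge0 ?(p_banach_ge0 NB).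
rewrite -cardfs_gt0 => A0; have /eqP/cardfs1P[a Aa] : #|` A| = 1%N by lia.
have [b bB] : exists b, b \in B by apply/fset0Pn; rewrite -cardfs_gt0; lia.
rewrite Aa /proj big_seq_fset1 (p_banach_homogeneous NB) mulrAC.
apply: ler_pM; rewrite ?modulus_ge0 ?(p_banach_ge0 NB)//; last by have [] := hV a 0.
have {dAB} := dAB a b; rewrite Aa in_fset1 eqxx bB => /(_ isT isT)/le_trans; apply.
have [+ _] := hV b (proj e es B x).
by rewrite coord_proj// bB.
Qed.

(** The set [A] lies in an interval below [B] and is cut along the sets that cover
this interval. Each cut costs a use of the quasi-triangle inequality, so the
number of covering sets has to be bounded uniformly. *)
Lemma interval_dominated Fam (D : R) : 0 <= D -> greedy_bound Fam D -> covers_intervals Fam ->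
  exists2 C : R, 0 <= C & forall (A B : {fset nat}) x,
    (#|` A| <= #|` B|)%N -> fset_before A B -> coord_dominated x A B ->
    N (proj e es A x) <= C * N (proj e es B x).
Proof.
move=> D0 gb [q cov]; have [k k1 tri] := quasi_triangle.
have [V V0 hV] := singleton_dominated; have k0 : 0 <= k by exact: le_trans k1.
have [C hC] : exists C : nat -> R, forall m, 0 <= C m /\ C m.+1 = k * (D + V + C m).
  exists (fix C m := if m is m'.+1 then k * (D + V + C m') else 0).
  by elim=> [//|m [C0 IH]]; split=> //; rewrite ?IH mulr_ge0// !addr_ge0.
have C0 m : 0 <= C m by case: (hC m).
(* Induction over the covering sets, removing from A the part inside the first one. *)
have key (B : {fset nat}) x (T : seq {fset nat}) (A : {fset nat}) :
    (forall G, G \in T -> (Fam G \/ (#|` G| <= 1)%N) /\ [disjoint G & B]%fset) ->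
    (forall n, n \in A -> exists2 G, G \in T & n \in G) ->
    (#|` A| <= #|` B|)%N -> fset_before A B -> coord_dominated x A B ->
    N (proj e es A x) <= C (size T) * N (proj e es B x).
  elim: T A => [|G T IH] A GT AT AB bAB dAB.
    have -> : A = fset0 by apply/fsetP => n; rewrite inE; apply/negP => /AT[].
    by rewrite proj_fset0 p_norm0 mulr_ge0 ?(p_banach_ge0 NB).
  have [_ CS] := hC (size T); rewrite [size _]/= CS.
  rewrite [proj e es A x](combination_split e G (es^~ x) A).
  apply: le_trans (tri _ _) _; rewrite -mulrA ler_wpM2l// mulrDl lerD//.
    have [FG GB] := GT G (mem_head _ _).
    have AGB : (#|` (A `&` G)%fset| <= #|` B|)%N.
      by apply: leq_trans AB; apply/fsubset_leq_card/fsubsetIl.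
    have bAG : fset_before (A `&` G)%fset B.
      by move=> i j; rewrite in_fsetI => /andP[iA _]; exact: bAB.
    have dAG : coord_dominated x (A `&` G)%fset B.
      by move=> i j; rewrite in_fsetI => /andP[iA _]; exact: dAB.
    case: FG => [FG|G1].
      apply: (@le_trans _ _ (D * N (proj e es B x))).
        by apply: (block_dominated D0 gb FG) => //; exact: fsubsetIr.
      by rewrite ler_wpM2r ?(p_banach_ge0 NB)// lerDl.
    apply: (@le_trans _ _ (V * N (proj e es B x))).
      apply: hV => //; apply: leq_trans G1; exact/fsubset_leq_card/fsubsetIr.
    by rewrite ler_wpM2r ?(p_banach_ge0 NB)// lerDr.
  apply: IH.
  - by move=> H HT; apply: GT; rewrite inE HT orbT.
  - move=> n; rewrite in_fsetD => /andP[nG /AT[H]]; rewrite inE => /orP[/eqP->|HT nH].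
      by rewrite (negPf nG).
    by exists H.
  - by apply: leq_trans AB; apply/fsubset_leq_card/fsubsetDl.
  - by move=> i j; rewrite in_fsetD => /andP[_ iA]; exact: bAB.
  - by move=> i j; rewrite in_fsetD => /andP[_ iA]; exact: dAB.
have Cmono m n : (m <= n)%N -> C m <= C n.
  elim: n => [|n IH]; first by rewrite leqn0 => /eqP->.
  rewrite leq_eqVlt => /orP[/eqP->//|]; rewrite ltnS => /IH/le_trans; apply.
  have [_ ->] := hC n; apply: (@le_trans _ _ (k * C n)).
    by rewrite ler_peMl.
  by rewrite ler_wpM2l// lerDr addr_ge0.
exists (C q) => // A B x AB bAB dAB.
(* All of A lies below this bound, and all of B at or beyond it. *)
have [T [Tq TF Tc]] := cov (\max_(n <- A) n.+1).
apply: (@le_trans _ _ (C (size T) * N (proj e es B x))); last first.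
  by rewrite ler_wpM2r ?(p_banach_ge0 NB)// Cmono.
apply: key => //.
  move=> G /TF[? /fsubsetP GI]; split=> //; apply/fdisjointP => n /GI.
  rewrite in_initial_segment => nA; apply/negP => nB.
  suff : (\max_(n <- A) n.+1 <= n)%N by lia.
  by apply/bigmax_leqP_seq => i iA _; exact: bAB.
move=> n nA; apply: Tc.
by have := @leq_bigmax_seq _ (enum_fset A) xpredT S n nA isT.
Qed.

(** With y = x - P_A x, the set L \ A is greedy for y, so the empty competitor
bounds y - P_{L \ A} y, hence also P_{L \ A} x, by a multiple of y. The remaining
piece P_{A \ L} x of x - P_L x is dominated by P_{L \ A} x because A \ L precedes
L \ A and is not larger. *)
Lemma covering_transfer Fam Fam' : Fam fset0 -> Fam' fset0 -> covers_intervals Fam ->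
  family_strong_partially_greedy N e es Fam ->
  family_strong_partially_greedy N e es Fam'.
Proof.
move=> F0 F'0 cov; rewrite !family_spgP// => -[D D1 gb].
have D0 : 0 <= D by exact: le_trans D1.
have [k k1 tri] := quasi_triangle; have k0 : 0 <= k by exact: le_trans k1.
have [C C0 hC] := interval_dominated D0 gb cov.
exists (k * (D + C * (k * (1 + D)))).
  apply: (@le_trans _ _ D) => //; apply: (@le_trans _ _ (k * D)).
    by rewrite ler_peMl.
  by rewrite ler_wpM2l// lerDl !mulr_ge0// addr_ge0.
move=> x m L A [Lm gL] _ Am bAL.
pose y := x - proj e es A x.
have yc j : es j y = if j \in A then 0 else es j x.
  rewrite (scalar_funB (esL j)) coord_proj//.
  by case: ifP => _; rewrite ?subrr ?subr0.
have projy : proj e es (L `\` A)%fset y = proj e es (L `\` A)%fset x.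
  by apply: eq_combination => n; rewrite in_fsetD yc => /andP[/negPf->].
have quasi : N (y - proj e es (L `\` A)%fset y) <= D * N y.
  have := gb y #|` (L `\` A)%fset| (L `\` A)%fset fset0.
  rewrite proj_fset0 subr0; apply; rewrite ?cardfs0//; last first.
    by move=> i j; rewrite fset0D.
  split=> // n j; rewrite !yc !in_fsetD => /andP[/negPf-> nL].
  case: ifP => [_ _|_ /= jL]; first by rewrite modulus0 modulus_ge0.
  exact: gL.
have cardA : (#|` (A `\` L)%fset| <= #|` (L `\` A)%fset|)%N.
  by rewrite !cardfsD fsetIC; apply: leq_sub2r; rewrite Lm.
have dom : N (proj e es (A `\` L)%fset x) <= C * N (proj e es (L `\` A)%fset x).
  apply: hC => // n j; rewrite !in_fsetD => /andP[nL _] /andP[_ jL].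
  exact: gL.
have -> : x - proj e es L x =
    (y - proj e es (L `\` A)%fset y) + proj e es (A `\` L)%fset x.
  rewrite projy /y [proj e es L x](combination_split e A (es^~ x) L).
  rewrite [proj e es A x](combination_split e L (es^~ x) A) fsetIC.
  rewrite -/(proj e es (L `\` A)%fset x) -/(proj e es (A `\` L)%fset x).
  set u := combination _ _ _; set v := proj e es _ x; set w := proj e es _ x.
  by rewrite !opprD !addrA (addrAC _ (- w) (- v)) subrK.
apply: le_trans (tri _ _) _; rewrite -mulrA ler_wpM2l// mulrDl lerD//.
apply: le_trans dom _; rewrite -mulrA ler_wpM2l// -projy.
have -> : proj e es (L `\` A)%fset y = y + - (y - proj e es (L `\` A)%fset y).
  by rewrite opprB addrC subrK.
apply: le_trans (tri _ _) _; rewrite -mulrA ler_wpM2l// p_normN mulrDl mul1r.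
by rewrite lerD2l.
Qed.

End Transfer.

(** * The space of a family of finite sets *)

Section SupremumSpace.
Variables (R : realType) (F : scalars) (Gs : set {fset nat}).
Local Notation K := (scalar_field R F).

(** The sequences that finitely supported ones approximate in the supremum norm
over [Gs]; this makes the unit vectors span a dense subspace. *)
Definition small_tails (x : nat -> K) : Prop :=
  forall eps : R, 0 < eps -> exists m, forall G, Gs G ->
    \sum_(n <- G | (m <= n)%N) modulus (x n) <= eps.

Definition small_tails_pred : {pred nat -> K^o} := [pred x | `[< small_tails x >]].

Lemma eventually0_small_tails x m : (forall n, (m <= n)%N -> x n = 0) -> small_tails x.
Proof.
move=> x0 eps eps0; exists m => G _; rewrite big1 ?ltW// => n /x0 ->.
exact: modulus0.
Qed.

Lemma small_tails_submod : submod_closed small_tails_pred.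
Proof.
split; first by apply/asboolP/(@eventually0_small_tails _ 0).
move=> c x y /asboolP xt /asboolP yt; apply/asboolP => eps eps0.
have c1 : 0 < modulus c + 1 by rewrite ltr_wpDl// modulus_ge0.
have e2 : 0 < eps / 2 by lra.
have [m xm] := xt (eps / 2 / (modulus c + 1)) (divr_gt0 e2 c1).
have [j yj] := yt (eps / 2) e2.
exists (maxn m j) => G GG; rewrite [leRHS]splitr.
have le_tail i (z : nat -> K) : (i <= maxn m j)%N ->
    \sum_(n <- G | (maxn m j <= n)%N) modulus (z n) <= \sum_(n <- G | (i <= n)%N) modulus (z n).
  move=> im; rewrite big_mkcond [leRHS]big_mkcond; apply: ler_sum => n _.
  by case: ifP => [/(leq_trans im)->//|_]; case: ifP => // _; exact: modulus_ge0.
apply: (@le_trans _ _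
    (\sum_(n <- G | (maxn m j <= n)%N) (modulus c * modulus (x n) + modulus (y n)))).
  by apply: ler_sum => n _; rewrite -modulusM; exact: modulusD.
rewrite big_split /= lerD//; last by apply: le_trans (yj _ GG); rewrite le_tail// leq_maxr.
rewrite -mulr_sumr; apply: (@le_trans _ _ ((modulus c + 1) * (eps / 2 / (modulus c + 1)))).
  apply: ler_pM; [exact: modulus_ge0 | apply: sumr_ge0 => n _; exact: modulus_ge0 | by rewrite lerDl |].
  by apply: le_trans (xm _ GG); rewrite le_tail// leq_maxl.
by rewrite mulrC divfK// gt_eqF.
Qed.

HB.instance Definition _ :=
  GRing.isSubmodClosed.Build K (nat -> K^o) small_tails_pred small_tails_submod.

Record sup_space := SupSpace { coords :> nat -> K^o; _ : coords \in small_tails_pred }.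
HB.instance Definition _ := [isSub for coords].
HB.instance Definition _ := [Choice of sup_space by <:].
HB.instance Definition _ := [SubChoice_isSubLmodule of sup_space by <:].

Implicit Types x y : sup_space.

Lemma coordsD x y n : (x + y) n = x n + y n.
Proof. by []. Qed.

Lemma coordsB x y n : (x - y) n = x n - y n.
Proof. by []. Qed.

Lemma coordsZ (c : K) x n : (c *: x) n = c * x n.
Proof. by []. Qed.

Lemma coords_scalar n : scalar (fun x : sup_space => x n : K).
Proof. by move=> c x y; rewrite coordsD coordsZ. Qed.

Lemma coords0 n : (0 : sup_space) n = 0.
Proof. by []. Qed.

Lemma sup_spaceP x y : (forall n, x n = y n) -> x = y.
Proof. by move=> xy; apply/val_inj/funext. Qed.

Definition of_small_tails (x : nat -> K) (xt : small_tails x) : sup_space :=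
  SupSpace (introT (asboolP _) xt).

Definition mass (G : {fset nat}) (x : nat -> K) : R := \sum_(n <- G) modulus (x n).

Lemma massD G (x y : nat -> K) : mass G (fun n => x n + y n) <= mass G x + mass G y.
Proof. by rewrite /mass -big_split; apply: ler_sum => n _; exact: modulusD. Qed.

Lemma mass_incl (G H : {fset nat}) (P : pred nat) (x : nat -> K) :
  (forall n, n \in G -> P n -> n \in H) ->
  \sum_(n <- G | P n) modulus (x n) <= mass H x.
Proof.
move=> GH; rewrite /mass (@big_fsetID _ _ _ _ (fun n => (n \in G) && P n)).
rewrite (@eq_fbigl_cond _ _ _ _ G [fset n in H | (n \in G) && P n]%fset P xpredT).
  by rewrite lerDl; apply: sumr_ge0 => n _; exact: modulus_ge0.
move=> n; rewrite !inE andbT; case nG: (n \in G); rewrite ?andbF//=.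
by case Pn: (P n); rewrite ?andbF// andbT; exact/esym/GH.
Qed.

Definition sup_norm x : R := sup [set mass G x | G in Gs].

(** Beyond some m the tails are at most 1, uniformly over [Gs], and the coordinates
below m contribute a fixed amount. *)
Lemma mass_ub x : has_ubound [set mass G x | G in Gs].
Proof.
have /asboolP/(_ 1 ltr01)[m xm] := valP x.
exists (mass (initial_segment m) x + 1) => _ [G GG <-].
rewrite /mass (bigID (fun n => (m <= n)%N)) /= addrC lerD//; last exact: xm.
by apply: mass_incl => n _; rewrite in_initial_segment ltnNge.
Qed.

Lemma mass_le_norm G x : Gs G -> mass G x <= sup_norm x.
Proof. by move=> GG; apply: (ub_le_sup (mass_ub x)); exists G. Qed.

Hypothesis Gs1 : forall n, Gs [fset n]%fset.

Lemma norm_leP x r : sup_norm x <= r <-> forall G, Gs G -> mass G x <= r.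
Proof.
split=> [xr G GG|xr]; first exact: le_trans (mass_le_norm x GG) xr.
by apply: ge_sup => [|_ [G GG <-]]; [exists (mass [fset 0%N]%fset x), [fset 0%N]%fset | exact: xr].
Qed.

Lemma coords_le_norm x n : modulus (x n) <= sup_norm x.
Proof. by have := mass_le_norm x (Gs1 n); rewrite /mass big_seq_fset1. Qed.

Lemma sup_norm_ge0 x : 0 <= sup_norm x.
Proof. exact: le_trans (modulus_ge0 _) (coords_le_norm x 0). Qed.

Lemma sup_normD x y : sup_norm (x + y) <= sup_norm x + sup_norm y.
Proof.
apply/norm_leP => G GG; apply: le_trans (lerD (mass_le_norm x GG) (mass_le_norm y GG)).
exact: (massD G x y).
Qed.

Lemma sup_normZ c x : sup_norm (c *: x) = modulus c * sup_norm x.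
Proof.
have massZ G : mass G (c *: x) = modulus c * mass G x.
  rewrite /mass mulr_sumr; apply: eq_bigr => n _.
  by rewrite coordsZ modulusM.
have [c0|c0] := eqVneq (modulus c) 0.
  apply/eqP; rewrite c0 mul0r eq_le sup_norm_ge0 andbT; apply/norm_leP => G _.
  by rewrite massZ c0 mul0r.
have cgt0 : 0 < modulus c by rewrite lt_def c0 modulus_ge0.
apply/eqP; rewrite eq_le; apply/andP; split.
  by apply/norm_leP => G GG; rewrite massZ ler_wpM2l ?modulus_ge0 ?mass_le_norm.
rewrite -ler_pdivlMl//; apply/norm_leP => G GG.
by rewrite ler_pdivlMl// -massZ mass_le_norm.
Qed.

Lemma mass_cvg (u : nat -> nat -> K) (l : nat -> K) (G : {fset nat}) (eps : R) :
  (forall n eps, 0 < eps -> exists k, forall m, (k <= m)%N -> modulus (u m n - l n) < eps) ->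
  0 < eps -> exists k, forall m, (k <= m)%N -> mass G (fun n => u m n - l n) < eps.
Proof.
move=> ul; rewrite /mass; elim: (enum_fset G) eps => [|n s IH] eps eps0.
  by exists 0%N => m _; rewrite big_nil.
have e2 : 0 < eps / 2 by lra.
have [[k uk] [j uj]] := (ul n _ e2, IH _ e2).
exists (maxn k j) => m; rewrite geq_max => /andP[/uk nm /uj sm].
by rewrite big_cons [ltRHS]splitr ltrD.
Qed.

(** Each coordinate is controlled by the norm, so a Cauchy sequence has a
coordinatewise limit; its distance to the sequence is bounded over one finite set
at a time, where coordinatewise convergence suffices, uniformly over [Gs]. *)
Lemma sup_norm_complete : norm_complete sup_norm.
Proof.
move=> u uC.
have /choice[l ul] n : exists l, forall eps : R, 0 < eps ->
    exists k, forall m, (k <= m)%N -> modulus (u m n - l) < eps.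
  apply: (@scalar_cauchy_cvg R F (fun m => u m n)) => eps /uC[k uk].
  exists k => i j ki kj; rewrite -coordsB.
  exact: le_lt_trans (coords_le_norm _ n) (uk i j ki kj).
have near (eps : R) : 0 < eps -> exists k, forall m, (k <= m)%N ->
    forall G, Gs G -> mass G (fun n => u m n - l n) <= eps.
  move=> eps0; have e2 : 0 < eps / 2 by lra.
  have [k uk] := uC _ e2; exists k => m km G GG.
  have [j lj] := mass_cvg G ul e2.
  have := lj _ (leq_maxr k j); have := uk m _ km (leq_maxl k j).
  set i := maxn k j => mi il; have := mass_le_norm (u m - u i) GG.
  have : mass G (fun n => u m n - l n) <=
      mass G (fun n => (u m - u i) n) + mass G (fun n => u i n - l n).
    rewrite -[leLHS](_ : mass G (fun n => (u m - u i) n + (u i n - l n)) = _).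
      exact: massD.
    by apply: eq_bigr => n _; rewrite coordsB addrA subrK.
  lra.
have lt : small_tails l.
  move=> eps eps0; have e2 : 0 < eps / 2 by lra.
  have [k uk] := near _ e2; have /asboolP/(_ _ e2)[m um] := valP (u k).
  exists m => G GG; rewrite [leRHS]splitr; apply: le_trans (lerD (um G GG) (uk k (leqnn k) G GG)).
  apply: (@le_trans _ _ (\sum_(n <- G | (m <= n)%N) (modulus (u k n) + modulus (u k n - l n)))).
    apply: ler_sum => n _; rewrite -[modulus (_ - _)]modulusN.
    have {1}-> : l n = u k n + - (u k n - l n) by rewrite opprB addrC subrK.
    exact: modulusD.
  rewrite big_split /= lerD2l; exact: mass_incl.
exists (of_small_tails lt) => eps eps0; have e2 : 0 < eps / 2 by lra.
have [k uk] := near _ e2; exists k => m km.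
apply: (@le_lt_trans _ _ (eps / 2)); last by lra.
by apply/norm_leP => G; exact: (uk m km G).
Qed.

Lemma sup_space_banach : p_banach sup_norm 1.
Proof.
split.
- exact: sup_norm_ge0.
- move=> x x0; apply: sup_spaceP => n; rewrite (coords0 n).
  by apply: modulus0_eq0; apply/eqP; rewrite eq_le modulus_ge0 andbT -x0 coords_le_norm.
- exact: sup_normZ.
- by move=> x y; rewrite !powRr1 ?sup_norm_ge0// sup_normD.
- exact: sup_norm_complete.
Qed.

Lemma indicator_small_tails (A : {fset nat}) : small_tails (fun n => (n \in A)%:R).
Proof.
apply: (@eventually0_small_tails _ (\max_(n <- A) n.+1)) => n An.
case nA: (n \in A) => //.
by have := leq_trans (@leq_bigmax_seq _ (enum_fset A) xpredT S n nA isT) An; rewrite ltnn.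
Qed.

Definition indicator (A : {fset nat}) : sup_space := of_small_tails (indicator_small_tails A).

Lemma mass_indicator (G A : {fset nat}) : mass G (indicator A) = #|` (G `&` A)%fset|%:R.
Proof.
rewrite card_fset_sum1 (@eq_fbigl_cond _ _ _ _ _ G xpredT [in A]); last first.
  by move=> n; rewrite !inE /= andbT.
rewrite natr_sum /mass [RHS]big_mkcond; apply: eq_bigr => n _ /=.
by case: ifP => _; rewrite ?modulus1 ?modulus0.
Qed.

Definition unit_vector (n : nat) : sup_space := indicator [fset n]%fset.

Definition coordinate (n : nat) (x : sup_space) : K := x n.

Lemma unit_coordinate : biorthogonal unit_vector coordinate.
Proof. by move=> m n; rewrite /coordinate /= in_fset1. Qed.

Lemma sup_norm_unit n : sup_norm (unit_vector n) = 1.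
Proof.
apply/eqP; rewrite eq_le; apply/andP; split.
  apply/norm_leP => G _; rewrite mass_indicator lern1.
  by rewrite -(cardfs1 n) fsubset_leq_card// fsubsetIr.
apply: le_trans (coords_le_norm _ n) => /=.
by rewrite in_fset1 eqxx modulus1.
Qed.

Lemma coordinate_dual n : in_dual sup_norm (coordinate n).
Proof.
split; first exact: coords_scalar.
by exists 1 => _ [x /= x1 <-]; apply: le_trans x1; exact: coords_le_norm.
Qed.

Lemma coordinate_dual_norm n : dual_norm sup_norm (coordinate n) = 1.
Proof.
have c1 : dual_values sup_norm (coordinate n) 1.
  exists (unit_vector n); first by rewrite /= sup_norm_unit.
  by rewrite unit_coordinate eqxx modulus1.
apply/eqP; rewrite eq_le; apply/andP; split.
  apply: ge_sup; first by exists 1.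
  by move=> _ [x /= x1 <-]; apply: le_trans x1; exact: coords_le_norm.
by apply: ub_le_sup => //; exact: (coordinate_dual n).2.
Qed.

Lemma unit_vector_dense : norm_dense sup_norm (\bigcup_m linear_span unit_vector m).
Proof.
move=> x eps eps0; have e2 : 0 < eps / 2 by lra.
have /asboolP/(_ _ e2)[m xm] := valP x.
exists (partial_sum unit_vector coordinate m x).
  by exists m => //; exists (fun i => coordinate i x).
apply: (@le_lt_trans _ _ (eps / 2)); last by lra.
apply/norm_leP => G GG; apply: le_trans (xm G GG).
rewrite /mass [leRHS]big_mkcond; apply: ler_sum => n _.
have := coord_proj coords_scalar unit_coordinate (initial_segment m) x n.
rewrite -partial_sum_proj in_initial_segment ltnNge coordsB /coordinate => ->.
by case: (m <= n)%N; rewrite /= ?subr0 // subrr modulus0.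
Qed.

Lemma unit_vector_basis : basis sup_norm unit_vector coordinate.
Proof.
have all1 r : (range (sup_norm \o unit_vector) `|` range (dual_norm sup_norm \o coordinate)) r -> r = 1.
  by case=> -[n _ <-]; rewrite /= ?sup_norm_unit ?coordinate_dual_norm.
split.
- exact: unit_vector_dense.
- exact: coordinate_dual.
- exact: unit_coordinate.
- move=> es' es'D es'B; apply: (dual_system_unique sup_space_banach unit_vector_dense) => //.
  + exact: coordinate_dual.
  + exact: unit_coordinate.
- apply: (@lt_le_trans _ _ 1) => //; apply: lb_le_inf => [|r /all1->//].
  by exists (sup_norm (unit_vector 0)); left; exists 0%N.
- by exists 1 => r /all1->.
Qed.

Lemma sup_space_separable : separable sup_norm.
Proof. exact: (dense_span_separable ltr01 sup_space_banach unit_vector_dense). Qed.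

Lemma sup_space_infinite_dimensional : infinite_dimensional sup_space.
Proof. exact: (biorthogonal_infinite_dimensional coords_scalar unit_coordinate). Qed.

End SupremumSpace.

(** * Transversals *)

Definition transversals (Fam : set {fset nat}) : set {fset nat} :=
  [set G : {fset nat} | forall A, Fam A -> forall i j,
     i \in G -> j \in G -> i \in A -> j \in A -> i = j].

Lemma transversal_singleton Fam n : transversals Fam [fset n]%fset.
Proof. by move=> A _ i j; rewrite !in_fset1 => /eqP-> /eqP->. Qed.

Section TransversalSpace.
Variables (R : realType) (F : scalars) (Fam : set {fset nat}).
Local Notation X := (sup_space R F (transversals Fam)).
Local Notation N := (@sup_norm R F (transversals Fam)).
Local Notation e := (@unit_vector R F (transversals Fam)).
Local Notation es := (@coordinate R F (transversals Fam)).

Let singl n : transversals Fam [fset n]%fset := @transversal_singleton Fam n.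
Let NB : p_banach N 1 := @sup_space_banach R F _ singl.

Lemma coords_proj (A : {fset nat}) (x : X) n :
  proj e es A x n = if n \in A then x n else 0.
Proof. exact: (coord_proj (@coords_scalar _ _ _) (@unit_coordinate _ _ _)). Qed.

(** On a transversal G, the coordinates of x - P_L x exceed those of x - P_A x in
modulus at one point of A \ L at most, and there by no more than any coordinate
of x in L \ A. *)
Lemma transversal_space_family_spg : Fam fset0 ->
  family_strong_partially_greedy N e es Fam.
Proof.
move=> Fam0; apply/(family_spgP NB) => //; exists 2; first by lra.
move=> x m L A [Lm gL] FA Am _; set y := x - proj e es A x.
apply/norm_leP => // G GG.
apply: (@le_trans _ _ (mass G y + \sum_(n <- G | n \in (A `\` L)%fset) modulus (x n))).
  rewrite /mass [X in _ <= _ + X]big_mkcond -big_split; apply: ler_sum => n _.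
  rewrite !coordsB !coords_proj in_fsetD /=.
  case: (n \in L) => /=; first by rewrite subrr modulus0 addr0 modulus_ge0.
  by case: (n \in A); rewrite ?subrr ?subr0 ?modulus0 ?add0r ?addr0.
rewrite mulr_natl mulr2n lerD ?mass_le_norm//.
have [GA0|[a]] := fset_0Vmem (G `&` (A `\` L))%fset.
  rewrite big_seq_cond big1 ?(sup_norm_ge0 singl)// => n /andP[nG nA].
  by have : n \in fset0 by rewrite -GA0 in_fsetI nG.
rewrite in_fsetI => /andP[aG aAL].
apply: (@le_trans _ _ (modulus (x a))).
  have <- : mass [fset a]%fset x = modulus (x a) by rewrite /mass big_seq_fset1.
  apply: mass_incl => n nG nAL; rewrite in_fset1; apply/eqP.
  by move: aAL nAL; rewrite !in_fsetD => /andP[_ aA] /andP[_ nA]; exact: GG FA _ _ _ _ _ _.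
have [LA0|[b]] := fset_0Vmem (L `\` A)%fset.
  have : (0 < #|` (A `\` L)%fset|)%N by rewrite cardfs_gt0; apply/fset0Pn; exists a.
  have := congr1 (fun H : {fset nat} => #|` H|) LA0; rewrite cardfs0 !cardfsD fsetIC.
  lia.
rewrite in_fsetD => /andP[bA bL].
apply: (@le_trans _ _ (modulus (y b))); last exact: coords_le_norm.
rewrite coordsB coords_proj (negPf bA) subr0; apply: gL => //.
by move: aAL; rewrite in_fsetD => /andP[].
Qed.

(** With G a large transversal inside the initial segment I and B a member of the
family beyond I of at least its size, the indicator of I u B has the greedy set
(I \ G) u B. It leaves the indicator of G, of norm |G|, while the partial sum over
I leaves the indicator of B, of norm at most 1. *)
Lemma transversal_space_not_spg :
  (forall n, exists2 G, transversals Fam G & (n <= #|` G|)%N) ->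
  (forall n k, exists A, [/\ Fam A, (n <= #|` A|)%N & forall i, i \in A -> (k <= i)%N]) ->
  ~ strong_partially_greedy N e es.
Proof.
move=> large_transversal far_members; have I0 := initial_segment_fset0.
move=> /(spg_initial NB)/(family_spgP NB _ _ I0)[D D1 gb].
have [G GG Gn] := large_transversal (Num.bound D).
pose q := \max_(n <- G) n.+1.
have Gq n : n \in G -> (n < q)%N.
  by move=> nG; exact: (@leq_bigmax_seq _ (enum_fset G) xpredT S n nG isT).
have [B [FB Bn Bq]] := far_members #|` G| q.
have [I [IR IE]] : exists I, range initial_segment I /\ forall n, (n \in I) = (n < q)%N.
  exists (initial_segment q); split; last exact: in_initial_segment.
  by exists q.
pose L := ((I `\` G) `|` B)%fset.
pose x : X := indicator R F (transversals Fam) (I `|` B)%fset.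
have IB n : n \in I -> n \in B -> False.
  by rewrite IE => ? /Bq; lia.
have GI n : n \in G -> n \in I by move=> /Gq; rewrite IE.
have gL : greedy_set es x #|` L| L.
  split=> // n j nL _; rewrite /coordinate /=.
  have -> : n \in (I `|` B)%fset.
    by move: nL; rewrite !inE => /orP[/andP[_ ->]//|->]; rewrite orbT.
  by case: (j \in _); rewrite ?modulus1 ?modulus0 ?ler01.
have LI : (#|` I| <= #|` L|)%N.
  have -> : #|` L| = (#|` (I `\` G)%fset| + #|` B|)%N.
    have IGB : ((I `\` G) `&` B)%fset = fset0 :> {fset nat}.
      apply/fsetP => n; rewrite !inE; apply/negP => /andP[/andP[_ nI] nB].
      exact: IB _ nI nB.
    by rewrite cardfsU IGB cardfs0 subn0.
  have GsI : (G `<=` I)%fset by apply/fsubsetP.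
  by rewrite cardfsDS//; have := fsubset_leq_card GsI; lia.
have := gb x _ L I gL IR LI.
have -> : x - proj e es L x = indicator R F (transversals Fam) G.
  apply: sup_spaceP => n; rewrite coordsB coords_proj /= !inE.
  case nG: (n \in G) => /=.
    rewrite (GI _ nG) /=; case nB: (n \in B); rewrite ?subr0//.
    by case: (IB n (GI _ nG) nB).
  by case: (n \in I); case: (n \in B); rewrite /= ?subrr ?subr0.
have -> : x - proj e es I x = indicator R F (transversals Fam) B.
  apply: sup_spaceP => n; rewrite coordsB coords_proj /= !inE.
  case nI: (n \in I) => /=; last by rewrite subr0.
  by rewrite subrr; case nB: (n \in B) => //; case: (IB n nI nB).
have NB1 : N (indicator R F (transversals Fam) B) <= 1.
  apply/norm_leP => // H HH; rewrite mass_indicator lern1.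
  have [->|[b]] := fset_0Vmem (H `&` B)%fset; first by rewrite cardfs0.
  rewrite in_fsetI => /andP[bH bB]; rewrite -(cardfs1 b); apply: fsubset_leq_card.
  apply/fsubsetP => i; rewrite in_fsetI in_fset1 => /andP[iH iB].
  by apply/eqP; exact: HH FB _ _ iH bH iB bB.
have bef : fset_before (I `\` L)%fset (L `\` I)%fset.
  move=> i j; rewrite !inE => /andP[_ iI] /andP[jI /orP[/andP[_]|/Bq]].
    by rewrite (negPf jI).
  by move: iI; rewrite IE => ? ?; exact: leq_trans (_ : i < q)%N _.
move=> /(_ bef).
have := mass_le_norm (indicator R F (transversals Fam) G) GG.
rewrite mass_indicator fsetIid.
have : D < #|` G|%:R.
  apply: lt_le_trans (archi_boundP _) _; first exact: le_trans D1.
  by rewrite ler_nat.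
move: NB1; set u := N _; set v := N _; move: D1 => {}D1 u1 Dn nv vDu.
have : D * u <= D by rewrite ler_piMr//; exact: le_trans D1.
lra.
Qed.

End TransversalSpace.

(** * Translates of partial sums *)

Section SumFamily.
Variables (a : nat -> nat) (a_gt0 : forall n, (0 < a n)%N).

Definition psum (j : nat) : nat := \sum_(i < j) a i.

Lemma psumS j : psum j.+1 = (psum j + a j)%N.
Proof. by rewrite /psum big_ord_recr. Qed.

Lemma psum_mono i j : (i < j)%N -> (psum i < psum j)%N.
Proof.
elim: j => // j IH; rewrite ltnS leq_eqVlt psumS => /orP[/eqP->|/IH]; have := a_gt0 j; lia.
Qed.

Lemma psum_homo i j : (i <= j)%N -> (psum i <= psum j)%N.
Proof. by rewrite leq_eqVlt => /orP[/eqP->|/psum_mono/ltnW]. Qed.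

Lemma leq_psum j : (j <= psum j)%N.
Proof. by elim: j => // j IH; rewrite psumS; have := a_gt0 j; lia. Qed.

Definition sum_block (k l : nat) : {fset nat} := [fset (k + psum j.+1).-1 | j in iota 0 l]%fset.

Lemma in_sum_block k l n :
  reflect (exists2 j, (j < l)%N & n.+1 = (k + psum j.+1)%N) (n \in sum_block k l).
Proof.
apply: (iffP (imfsetP _ _ _ _)) => /= -[j].
  rewrite mem_iota => /andP[_ jl] ->; exists j => //.
  by have := leq_psum j.+1; lia.
by move=> jl nE; exists j; rewrite ?mem_iota// -nE.
Qed.

Lemma card_sum_block k l : #|` sum_block k l| = l.
Proof.
rewrite card_in_imfset /=; first by rewrite undup_id ?iota_uniq ?size_iota.
move=> i j _ _ ij; have := leq_psum i.+1; have := leq_psum j.+1.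
by have [/psum_mono|/psum_mono|//] := ltngtP i.+1 j.+1; lia.
Qed.

Lemma sum_block0 k : sum_block k 0 = fset0.
Proof. by apply/fsetP => n; rewrite inE; apply/in_sum_block => -[]. Qed.

Lemma sum_family_block k l : sum_family a (sum_block k l).
Proof.
by have [->|l0] := posnP l; [left; exact: sum_block0 | right; exists k, l].
Qed.

Lemma sum_familyE A : sum_family a A -> exists k l, A = sum_block k l.
Proof. by case=> [->|[k [l [_ ->]]]]; [exists 0%N, 0%N; rewrite sum_block0 | exists k, l]. Qed.

Lemma sum_family_far n k : exists A, [/\ sum_family a A, (n <= #|` A|)%N &
  forall i, i \in A -> (k <= i)%N].
Proof.
exists (sum_block k n); split; [exact: sum_family_block | by rewrite card_sum_block |].
by move=> i /in_sum_block[j _]; have := leq_psum j.+1; lia.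
Qed.

(** As the gaps are at most [M], every n beyond the first partial sum is less than
[M] above the last partial sum before it, hence lies in one of [M] translates. *)
Lemma sum_family_covers M : (forall n, (a n <= M)%N) -> covers_intervals (sum_family a).
Proof.
move=> aM; exists (M + M)%N => k.
(* The part of the translate by i inside the interval is again a block. *)
have trunc i : exists l, forall j, (j < l)%N = (i + psum j.+1 <= k)%N.
  have ex : exists j, (k < i + psum j.+1)%N.
    by exists k; have := leq_psum k.+1; lia.
  case: (ex_minnP ex) => l kl lmin; exists l => j.
  have [jl|lj] := ltnP j l; first by have := contraNN (lmin j); lia.
  by have [/eqP|/eqP|] := ltngtP l j => // ?; first have := @psum_mono l.+1 j.+1; subst; lia.
have [l lE] := choice trunc.
pose T := [seq sum_block i (l i) | i <- iota 0 M] ++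
          [seq if (i < k)%N then [fset i]%fset else fset0 | i <- iota 0 M].
exists T; split; first by rewrite size_cat !size_map size_iota.
  move=> A; rewrite mem_cat => /orP[] /mapP[i _ ->].
    split; first by left; exact: sum_family_block.
    apply/fsubsetP => n /in_sum_block[j]; rewrite lE in_initial_segment; lia.
  split; first by right; case: ifP => _; rewrite ?cardfs1 ?cardfs0.
  by case: ifP => ik; rewrite ?fsub0set// fsub1set in_initial_segment.
move=> n nk; have [nM|Mn] := ltnP n M.
  exists [fset n]%fset; last exact: fset11.
  rewrite mem_cat; apply/orP; right; apply/mapP; exists n; rewrite ?mem_iota//.
  by rewrite nk.
have [j [i [iM nE]]] : exists j i, (i < a j.+1)%N /\ n.+1 = (i + psum j.+1)%N.
  have : (a 0%N <= n.+1)%N by have := aM 0%N; lia.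
  elim: (n.+1) => [|r IH]; first by have := a_gt0 0%N; lia.
  rewrite leq_eqVlt => /orP[/eqP <-|/IH[j [i [ia rE]]]].
    by exists 0%N, 0%N; rewrite a_gt0 psumS /psum big_ord0.
  have [ia'|ai] := ltnP i.+1 (a j.+1); first by exists j, i.+1; rewrite ia' rE.
  by exists j.+1, 0%N; rewrite a_gt0 psumS; split=> //; lia.
exists (sum_block i (l i)).
  rewrite mem_cat; apply/orP; left; apply/mapP; exists i; rewrite ?mem_iota//.
  by have := aM j.+1; lia.
by apply/in_sum_block; exists j => //; rewrite lE -nE.
Qed.

(** Each new point is placed inside a gap that is longer than all the earlier
points. *)
Lemma sum_family_transversal : (forall M, exists n, (M < a n)%N) ->
  forall n, exists2 G, transversals (sum_family a) G & (n <= #|` G|)%N.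
Proof.
move=> aub n.
suff [G [b [GT Gn Gb]]] : exists G b, [/\ transversals (sum_family a) G, (n <= #|` G|)%N &
    forall i, i \in G -> (i < b)%N] by exists G.
elim: n => [|n [G [b [GT Gn Gb]]]].
  by exists fset0, 0%N; split => // A _ i j; rewrite in_fset0.
have [r ar] := aub b.+1; pose c := (psum r + b)%N.
have cG : c \notin G by apply/negP => /Gb; rewrite /c; lia.
(* The translation k is at most i < b, so c.+1 - k would be a partial sum strictly
   between two consecutive ones. *)
have lonely A i : sum_family a A -> i \in G -> i \in A -> c \in A -> False.
  move=> /sum_familyE[k [l ->]] iG /in_sum_block[j _ jE] /in_sum_block[s _ sE].
  have := Gb _ iG; have := leq_psum j.+1.
  have := psumS r; have [sr|rs] := leqP s.+1 r.
    by have := psum_homo sr; move: sE; rewrite /c; lia.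
  by have := psum_homo rs; move: sE; rewrite /c; lia.
exists (c |` G)%fset, c.+1; split.
- move=> A FA i j; rewrite !in_fset1U => /orP[/eqP->|iG] /orP[/eqP->|jG] //.
  + by move=> cA jA; case: (lonely A j FA jG jA cA).
  + by move=> iA cA; case: (lonely A i FA iG iA cA).
  + exact: GT.
- by rewrite cardfsU1 cG; lia.
- move=> i; rewrite in_fset1U => /orP[/eqP->//|/Gb]; rewrite /c; lia.
Qed.

End SumFamily.

Theorem theorem2p6 (R : realType) (F : scalars) (a : nat -> nat)
    (a_gt0 : forall n, (0 < a n)%N) :
  (exists M : nat, forall n, (a n <= M)%N) <->
  (forall (p : R) (X : lmodType (scalar_field R F)) (N : X -> R)
      (e : nat -> X) (es : nat -> X -> scalar_field R F),
    0 < p -> p <= 1 -> p_banach N p -> separable N -> infinite_dimensional X ->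
    basis N e es ->
    (family_strong_partially_greedy N e es (sum_family a) <->
     strong_partially_greedy N e es)).
Proof.
have F0 : sum_family a fset0 by left.
split=> [[M aM] p X N e es p0 _ NB _ _ Bas|h].
  rewrite (spg_initial NB); have I0 := initial_segment_fset0.
  split; apply: (covering_transfer p0 NB Bas) => //; last exact: initial_segments_cover.
  exact: sum_family_covers aM.
apply: contrapT => aub; have singl := @transversal_singleton (sum_family a).
apply: (@transversal_space_not_spg R F (sum_family a)).
- apply: sum_family_transversal => // M; apply: contrapT => /forallNP aM; apply: aub.
  by exists M => n; rewrite leqNgt; apply/negP; exact: aM.
- by move=> n k; exact: sum_family_far.
apply/(h 1) => //; last exact: transversal_space_family_spg.
- exact: sup_space_banach.
- exact: sup_space_separable.
- exact: sup_space_infinite_dimensional.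
- exact: unit_vector_basis.
Qed.
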